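(* For real $x\geq 3$, let $w(x)$ denote the largest integer $w\geq 1$ for which there exist integers $m\geq 1$, $y\geq 1$ and integers $1\leq n_1<n_2<\dots<n_m\leq x$ such that $n_1 n_2\cdots n_m=y^{w}$. Let $L(x):=\sqrt{\log x\,\log\log x}$. Then, as $x\to+\infty$, \[w(x)=x\exp\big(-(\sqrt{2}+o(1))L(x)\big),\] that is, for every $\varepsilon>0$ there exists $x_0$ such that for all $x\geq x_0$, \[x\exp\big(-(\sqrt{2}+\varepsilon)L(x)\big)\leq w(x)\leq x\exp\big(-(\sqrt{2}-\varepsilon)L(x)\big).\]
   Context: $\log$ denotes the natural logarithm.
   Formalization: The base is required to satisfy y ≥ 2 instead of y ≥ 1, since m = n_1 = y = 1 gives 1 = 1^w for every w and then no largest w exists; only the configuration {n_i} = {1} is excluded. *)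

(* Defs.v *)
From mathcomp Require Import all_boot all_order all_algebra.
From mathcomp Require Import boolp classical_sets reals sequences exp.

Set Implicit Arguments.
Unset Strict Implicit.
Unset Printing Implicit Defensive.

Import Order.TTheory GRing.Theory Num.Theory.

Local Open Scope ring_scope.

(* The list s is n_1 < ... < n_m with m >= 1.  The base y is required to be at
   least 2: otherwise m = n_1 = y = 1 would give 1 = 1 ^ w for every w, and no
   largest w would exist.  This excludes only the case m = n_1 = 1, since for
   w >= 1 the value y = 1 forces every n_i to be 1. *)
Definition power_of_distinct (R : realType) (x : R) (w : nat) : Prop :=
  exists (s : seq nat) (y : nat),
    [/\ s != [::],
        sorted ltn s,
        (forall n, n \in s -> (1 <= n)%N /\ n%:R <= x),
        (2 <= y)%N
      & (\prod_(n <- s) n = y ^ w)%N].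

Definition is_largest_exponent (R : realType) (x : R) (w : nat) : Prop :=
  [/\ (1 <= w)%N,
      power_of_distinct x w
    & forall v, (1 <= v)%N -> power_of_distinct x v -> (v <= w)%N].

(* The default value 0 is never used for x >= 3: see largest_exponentP. *)
Definition largest_exponent (R : realType) (x : R) : nat :=
  xget 0%N (is_largest_exponent x).

Definition Lfun (R : realType) (x : R) : R := Num.sqrt (ln x * ln (ln x)).

Lemma power_of_distinct_bound (R : realType) (x : R) (w : nat) :
  3 <= x -> power_of_distinct x w ->
  (w <= Num.truncn x ^ Num.truncn x)%N.
Proof.
move=> x3 [s [y [_ ss sx y2 sE]]].
set N := Num.truncn x.
have x0 : 0 <= x by apply: le_trans x3.
have sN n : n \in s -> (1 <= n <= N)%N.
  by move=> /sx[-> nx]; rewrite truncn_ge_nat.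
have N0 : (0 < N)%N by rewrite truncn_gt0 (le_trans _ x3)// ler1n.
have us : uniq s by exact: sorted_uniq ltn_trans ltnn _ ss.
have size_s : (size s <= N)%N.
  rewrite -(size_iota 1 N); apply: uniq_leq_size => // n /sN.
  by rewrite mem_iota add1n ltnS.
have prod_s : (\prod_(n <- s) n <= N ^ size s)%N.
  elim: (s) sN => [|a t IH] tN; first by rewrite big_nil.
  rewrite big_cons expnS leq_mul//.
    by have /andP[] := tN a (mem_head _ _).
  by apply: IH => n nt; apply: tN; rewrite inE nt orbT.
apply: leq_trans (leq_trans prod_s (leq_pexp2l N0 size_s)).
by rewrite sE ltnW// ltn_expl.
Qed.

Lemma largest_exponentP (R : realType) (x : R) :
  3 <= x -> is_largest_exponent x (largest_exponent x).
Proof.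
move=> x3; apply: (xgetPex 0%N).
pose P w := (1 <= w)%N && `[< power_of_distinct x w >].
have exP : exists w, P w.
  exists 1%N; apply/andP; split=> //; apply/asboolP.
  exists [:: 2%N], 2%N; split=> //.
  - move=> n; rewrite inE => /eqP ->; split=> //.
    by apply: le_trans x3; rewrite ler_nat.
  - by rewrite big_seq1.
have ubP w : P w -> (w <= Num.truncn x ^ Num.truncn x)%N.
  by move=> /andP[_ /asboolP]; exact: power_of_distinct_bound.
have [w /andP[w1 /asboolP Pw] wmax] := ex_maxnP exP ubP.
exists w; split=> // v v1 Pv; apply: wmax.
by apply/andP; split=> //; apply/asboolP.
Qed.

Lemma is_largest_exponentE (R : realType) (x : R) (w : nat) :
  is_largest_exponent x w -> largest_exponent x = w.
Proof.
move=> Pw; apply: xget_unique => // v Pv.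
case: Pw Pv => w1 Pw wmax [v1 Pv vmax].
by apply/eqP; rewrite eqn_leq wmax//= vmax.
Qed.

(* Main.v *)
Require Import Defs.
From mathcomp Require Import all_boot all_order all_algebra.
From mathcomp Require Import boolp classical_sets reals sequences exp.
From mathcomp Require Import ring lra.

(** Write [Psi N y] for the number of [y]-smooth integers in [[1, N]].

    Lower bound: if [w = 2 ^ k], Olson's theorem on zero-sum sequences in
    [(Z/w)^r], applied to the exponent vectors of the smooth numbers, gives a
    [w]-th power as soon as [Psi N y] exceeds [1 + y (w - 1)]; hence [w(x)] is at
    least [Psi x y / (4 y)].  Counting pairs [(p, n)] with [p | n] and [p] a
    prime in [(y ^ (1 - d), y]], and using Mertens' theorem, bounds [Psi] from
    below by iteration; [y = exp (L / sqrt 2)] is the optimal choice.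

    Upper bound: if the product is [b ^ w] and [p] is the largest prime factor of
    [b], all factors are [p]-smooth, and comparing [p]-adic valuations gives
    [w <= log2 x * Psi (x / p) p].  Rankin's trick bounds this by
    [x exp (- ln p - (1 - e) L ^ 2 / (2 ln p) + o(L))], and AM-GM concludes. *)

Set Implicit Arguments.
Unset Strict Implicit.
Unset Printing Implicit Defensive.

Import Order.TTheory GRing.Theory Num.Theory.

(** * Zero-sum subsequences modulo a power of two *)
Definition mdiff (v : nat) (f : nat -> bool) (a : nat) : bool := f (a * v) (+) f a.

(* All [d]-fold multiplicative differences of [f] vanish: seen as a function of
   exponent vectors with values in [F_2], [f] is a polynomial of degree [< d]. *)
Fixpoint deg_lt (d : nat) (f : nat -> bool) : Prop :=
  if d is d'.+1 then forall v, 0 < v -> deg_lt d' (mdiff v f)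
  else forall a, 0 < a -> f a = false.

Lemma eq_deg_lt d f g :
  (forall a, 0 < a -> f a = g a) -> deg_lt d f -> deg_lt d g.
Proof.
elim: d f g => [|d IH] f g fg /= Hf; first by move=> a a0; rewrite -fg // Hf.
move=> v v0; apply: IH (Hf v v0) => a a0.
by rewrite /mdiff !fg // muln_gt0 a0.
Qed.

Lemma deg_ltS d f : deg_lt d f -> deg_lt d.+1 f.
Proof.
elim: d f => [|d IH] f /= Hf v v0; last exact: IH (Hf v v0).
by move=> a a0; rewrite /mdiff !Hf // muln_gt0 a0.
Qed.

Lemma deg_lt_add d f g :
  deg_lt d f -> deg_lt d g -> deg_lt d (fun a => f a (+) g a).
Proof.
elim: d f g => [|d IH] f g /= Hf Hg; first by move=> a a0; rewrite Hf ?Hg.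
move=> v v0; apply: eq_deg_lt (IH _ _ (Hf v v0) (Hg v v0)) => a _.
by rewrite /mdiff addbACA.
Qed.

Lemma deg_lt_shift d f u : 0 < u -> deg_lt d f -> deg_lt d (fun a => f (a * u)).
Proof.
move=> u0; elim: d f => [|d IH] f /= Hf.
  by move=> a a0; rewrite Hf // muln_gt0 a0.
move=> v v0; apply: eq_deg_lt (IH _ (Hf v v0)) => a _.
by rewrite /mdiff mulnAC.
Qed.

Lemma deg_lt0_zero d f : (forall a, 0 < a -> f a = false) -> deg_lt d f.
Proof.
elim: d f => [|d IH] f //= Hf v v0; apply: IH => a a0.
by rewrite /mdiff !Hf // muln_gt0 a0.
Qed.

(** Induction on both degrees through the Leibniz rule [leib]; the shifted factor [g (a * v)] has
    the same degree bound as [g]. *)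
Lemma deg_lt_mul d e f g : deg_lt d.+1 f -> deg_lt e.+1 g ->
  deg_lt (d + e).+1 (fun a => f a && g a).
Proof.
have leib v a (f' g' : nat -> bool) : mdiff v (fun a => f' a && g' a) a =
    (mdiff v f' a && g' (a * v)) (+) (f' a && mdiff v g' a).
  by rewrite /mdiff; case: (f' _) (f' a) (g' _) (g' a) => [] [] [] [].
elim: d e f g => [|d IHd].
  elim=> [|e IHe] f g Hf Hg v v0.
    move=> a a0; rewrite leib (Hf v v0 a a0) (Hg v v0 a a0).
    by rewrite andbF.
  apply: eq_deg_lt (IHe _ _ Hf (Hg v v0)) => a a0.
  by rewrite leib (Hf v v0 a a0).
elim=> [|e IHe] f g Hf Hg v v0.
  apply: eq_deg_lt (IHd 0 _ _ (Hf v v0) (deg_lt_shift v0 Hg)) => a a0.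
  by rewrite leib (Hg v v0 a a0) andbF addbF.
have H1 := IHd e.+1 _ _ (Hf v v0) (deg_lt_shift v0 Hg).
have H2 := IHe _ _ Hf (Hg v v0).
rewrite addSnnS in H2.
apply: eq_deg_lt (deg_lt_add H1 H2) => a a0.
by rewrite leib.
Qed.

(** By Pascal's rule, a unit step in the valuation lowers [m] by one. A difference by [v] splits
    into [logn p v] unit steps at varying offsets, hence the free [c]. *)
Lemma deg_lt_bin p c m : deg_lt m.+1 (fun a => odd 'C(logn p a + c, m)).
Proof.
elim: m c => [|m IH] c; first by move=> v v0 a a0; rewrite /mdiff !bin0.
move=> v v0.
suff H k : deg_lt m.+1
    (fun a => odd 'C(logn p a + (k + c), m.+1) (+) odd 'C(logn p a + c, m.+1)).
  apply: eq_deg_lt (H (logn p v)) => a a0.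
  by rewrite /mdiff lognM // addnA.
elim: k => [|k IHk]; first by apply: deg_lt0_zero => a a0; rewrite addbb.
apply: eq_deg_lt (deg_lt_add (IH (k + c)) IHk) => a a0.
by rewrite addSn addnS binS oddD (addbC (odd 'C(_, m.+1)) (odd 'C(_, m))) addbA.
Qed.

(** The sum over F_2 of [f (a * \prod_(n <- t) n)], with [t] running over all subsequences of
    [ns]. *)
Fixpoint sub_sum (ns : seq nat) (f : nat -> bool) (a : nat) : bool :=
  if ns is n :: ns' then sub_sum ns' f (a * n) (+) sub_sum ns' f a else f a.

(** Pairing the subsequences with and without [n] turns the sum into an iterated difference, which
    vanishes in low degree. *)
Lemma sub_sum_mdiff ns n f a :
  sub_sum (n :: ns) f a = sub_sum ns (mdiff n f) a.
Proof. by elim: ns a => //= k ns IH a; rewrite -!IH /= mulnAC addbACA. Qed.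

Lemma sub_sum_deg ns f a : 0 < a -> all (leq 1) ns ->
  deg_lt (size ns) f -> sub_sum ns f a = false.
Proof.
move=> a0; elim: ns f => [|n ns IH] f; first by move=> _ /= ->.
move=> /= /andP[n0 ns0] Hf; rewrite -[LHS]/(sub_sum (n :: ns) f a).
by rewrite sub_sum_mdiff IH //; apply: Hf.
Qed.

(** The empty subsequence contributes [f a], so a different total comes from some other
    subsequence. *)
Lemma sub_sum_subseq ns f a : sub_sum ns f a != f a ->
  exists t, [/\ t != [::], subseq t ns & f (a * \prod_(n <- t) n)].
Proof.
have aux ns' a' : sub_sum ns' f a' ->
    exists t, subseq t ns' /\ f (a' * \prod_(n <- t) n).
  elim: ns' a' => [|n ns' IH] a' /=.
    by move=> fa; exists [::]; rewrite big_nil muln1.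
  case H: (sub_sum ns' f a').
    by have [t [st ft] _] := IH _ H; exists t; split=> //; apply: subseq_trans st (subseq_cons _ _).
  rewrite addbF => /IH[t [st ft]]; exists (n :: t).
  by rewrite /= eqxx big_cons mulnA.
elim: ns a => [|n ns IH] a; first by rewrite eqxx.
have [E|H _] /= := eqVneq (sub_sum ns f a) (f a); last first.
  have [t [t0 st ft]] := IH _ H; exists t; split=> //.
  exact: subseq_trans st (subseq_cons _ _).
rewrite E => H.
have /aux[t [st ft]] : sub_sum ns f (a * n).
  by case: (sub_sum ns f (a * n)) (f a) H => [] [].
by exists (n :: t); split; rewrite //= ?eqxx // big_cons mulnA.
Qed.

(* The binomial coefficient is odd iff [2 ^ k] divides [a]: divisibility by
   [2 ^ k] is a polynomial condition of degree [2 ^ k - 1] over [F_2]. *)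
Lemma odd_bin_dvd k a : odd 'C(a + (2 ^ k).-1, (2 ^ k).-1) -> 2 ^ k %| a.
Proof.
move=> Ho; have w0 : 0 < 2 ^ k by rewrite expn_gt0.
(* With w = 2^k this reads (a + w) C(a + w - 1, w - 1) = w C(a + w, w). An odd binomial is coprime
   to w, so w divides a + w. *)
have := mul_bin_diag (a + (2 ^ k).-1).+1 (2 ^ k).-1; rewrite /= prednK // => E.
have : 2 ^ k %| (a + (2 ^ k).-1).+1 * 'C(a + (2 ^ k).-1, (2 ^ k).-1).
  by rewrite E dvdn_mulr.
rewrite Gauss_dvdl; last by rewrite coprimeXl // coprime2n.
by rewrite -addnS prednK // dvdn_addl.
Qed.

(* Olson's bound for the group [(Z/2^k)^r], with [r = size ps]: the sum over all
   subsequences of a polynomial of degree [< size ns] is even, and the empty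
   subsequence contributes 1. *)
Lemma zero_sum_pow2 k (ps ns : seq nat) : all (leq 1) ns ->
  size ps * (2 ^ k).-1 < size ns ->
  exists t, [/\ t != [::], subseq t ns
    & forall p, p \in ps -> 2 ^ k %| logn p (\prod_(n <- t) n)].
Proof.
move=> ns0; set w := (2 ^ k).-1 => sz.
pose f a := all (fun p => odd 'C(logn p a + w, w)) ps.
have degf : deg_lt (size ps * w).+1 f.
  rewrite /f; elim: (ps) => [|p s IH] /=; first by move=> v v0 a a0.
  by rewrite mulSn; apply: deg_lt_mul (deg_lt_bin p w w) IH.
have mono d e g : d <= e -> deg_lt d g -> deg_lt e g.
  by move/subnK <-; elim: (e - d) => //= i IH /IH /deg_ltS.
have f1 : f 1 by apply/allP => p _; rewrite logn1 add0n binn.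
have /sub_sum_subseq[t [t0 st ft]] : sub_sum ns f 1 != f 1.
  by rewrite f1 sub_sum_deg //; apply: mono degf.
exists t; split=> // p pps; apply: odd_bin_dvd.
by move: ft; rewrite mul1n => /allP/(_ p pps).
Qed.

Local Open Scope ring_scope.

(** * Smooth numbers *)

Definition smooth (y n : nat) : bool := all (fun p => p <= y)%N (primes n).

Definition Psi (N y : nat) : nat := (\sum_(1 <= n < N.+1 | smooth y n) 1)%N.

Lemma smoothP y n : (0 < n)%N ->
  reflect (forall p, prime p -> p %| n -> p <= y)%N (smooth y n).
Proof.
move=> n0; apply: (iffP allP) => H p.
  by move=> pp pn; apply: H; rewrite mem_primes pp n0.
by rewrite mem_primes => /and3P[pp _ pn]; apply: H.
Qed.

Lemma smoothM y q m : prime q -> (q <= y)%N -> (0 < m)%N ->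
  smooth y (q * m) = smooth y m.
Proof.
move=> pq qy m0; have q0 := prime_gt0 pq.
apply/smoothP/smoothP => //; rewrite ?muln_gt0 ?q0 // => H p pp.
  by move=> pm; apply: H => //; apply: dvdn_mull.
by rewrite Euclid_dvdM // => /orP[|/H]; [move/(dvdn_leq q0)/leq_trans; apply | apply].
Qed.

Lemma sum_multiples (q N : nat) (P : pred nat) (F : nat -> nat) : (0 < q)%N ->
  (\sum_(1 <= n < N.+1 | P n && (q %| n)) F n =
   \sum_(1 <= m < (N %/ q).+1 | P (q * m)) F (q * m))%N.
Proof.
move=> q0; elim: N => [|N IH]; first by rewrite div0n !big_geq.
rewrite big_mkcond big_nat_recr //= -big_mkcond IH divnS //.
case: (boolP (q %| N.+1)%N) => [qN|_]; last by rewrite andbF addn0.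
rewrite add1n andbT big_mkcond [RHS]big_mkcond [RHS]big_nat_recr //=.
have -> : (q * (N %/ q).+1 = N.+1)%N.
  by rewrite -[RHS](divnK qN) divnS // qN mulnC.
by [].
Qed.

Lemma Psi_multiples q N y : prime q -> (q <= y)%N ->
  (\sum_(1 <= n < N.+1 | smooth y n && (q %| n)) 1 = Psi (N %/ q) y)%N.
Proof.
move=> pq qy; rewrite sum_multiples ?prime_gt0 // big_nat_cond [RHS]big_nat_cond.
apply: eq_bigl => m; case: (boolP (_ <= _ < _)%N) => //= /andP[m0 _].
exact: smoothM.
Qed.

(** Buchstab's identity: the numbers counted on the left that are prime to [y.+1] are [y]-smooth,
    and the others are [y.+1] times a [y.+1]-smooth number. *)
Lemma Psi_primeS N y : prime y.+1 ->
  Psi N y.+1 = (Psi N y + Psi (N %/ y.+1) y.+1)%N.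
Proof.
move=> py; rewrite -(Psi_multiples N py (leqnn _)) {1}/Psi.
rewrite (bigID (fun n => y.+1 %| n)%N) /= addnC; congr (_ + _)%N.
rewrite /Psi big_nat_cond [RHS]big_nat_cond; apply: eq_bigl => n.
case: (boolP (_ <= _ < _)%N) => //= /andP[n0 _].
apply/andP/(smoothP _ n0) => [[/(smoothP _ n0) H yn] p pp pn|H].
  have := H p pp pn; rewrite leq_eqVlt => /orP[/eqP E|//].
  by rewrite -E pn in yn.
split; first by apply/(smoothP _ n0) => p pp pn; apply: leqW; apply: H.
by apply/negP => /(H _ py); rewrite ltnn.
Qed.

Lemma Psi_nprimeS N y : ~~ prime y.+1 -> Psi N y.+1 = Psi N y.
Proof.
move=> py; rewrite /Psi big_nat_cond [RHS]big_nat_cond; apply: eq_bigl => n.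
case: (boolP (_ <= _ < _)%N) => //= /andP[n0 _].
apply/smoothP/smoothP => // H p pp pn; have := H p pp pn; last exact: leqW.
rewrite leq_eqVlt => /orP[/eqP E|//]; by rewrite -E pp in py.
Qed.

Lemma leq_Psi N y z : (y <= z)%N -> (Psi N y <= Psi N z)%N.
Proof.
move/subnK <-; elim: (z - y)%N => // i; rewrite addSn => /leq_trans; apply.
by have [/Psi_primeS->|/Psi_nprimeS->] := boolP (prime (i + y).+1); rewrite ?leq_addr.
Qed.

Lemma Psi_small N y : (N <= y)%N -> Psi N y = N.
Proof.
move=> Ny; rewrite -[RHS]subn0 -subSS -[RHS]muln1 -sum_nat_const_nat.
rewrite /Psi big_nat_cond [RHS]big_nat_cond; apply: eq_bigl => n.
case: (boolP (_ <= _ < _)%N) => //= /andP[n0 nN].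
apply/(smoothP _ n0) => p _ /(dvdn_leq n0) /leq_trans; apply.
exact: leq_trans Ny.
Qed.

(** Splits off the number 1: its exponent vector is zero, so it would be a useless zero-sum sequence
    by itself. *)
Lemma PsiE N y : (0 < N)%N ->
  Psi N y = (size [seq n <- iota 2 N.-1 | smooth y n]).+1.
Proof.
move=> N0; rewrite /Psi sum1_count -size_filter /index_iota subSS subn0.
by rewrite -{1}(prednK N0).
Qed.

Lemma prod_primes_logn n : (0 < n)%N ->
  n = (\prod_(p <- primes n) p ^ logn p n)%N.
Proof. by move=> n0; rewrite {1}(prod_prime_decomp n0) prime_decompE big_map. Qed.

Lemma prime_dvd_prod_seq p (s : seq nat) : prime p ->
  (p %| \prod_(n <- s) n)%N -> exists2 n, n \in s & (p %| n)%N.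
Proof.
move=> pp; elim: s => [|a s IH]; first by rewrite big_nil Euclid_dvd1.
rewrite big_cons Euclid_dvdM // => /orP[pa|/IH[n ns pn]].
  by exists a; rewrite ?mem_head.
by exists n; rewrite // inE ns orbT.
Qed.

(** The distinct primes above [a] dividing [n] have a product at most [n], hence below
    [a ^ J.+1]. *)
Lemma count_large_primes_leq a b J n : (0 < n)%N -> (n < a ^ J.+1)%N ->
  (\sum_(a.+1 <= p < b | prime p && (p %| n)) 1 <= J)%N.
Proof.
move=> n0 naJ; rewrite sum1_count -size_filter.
set s := filter _ _; pose t := [seq p <- primes n | a < p]%N.
have st : (size s <= size t)%N.
  apply: uniq_leq_size; first by rewrite filter_uniq ?iota_uniq.
  move=> p; rewrite mem_filter mem_index_iota => /andP[/andP[pp pn] /andP[ap _]].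
  by rewrite mem_filter ap mem_primes pp n0.
apply: leq_trans st _; rewrite -ltnS.
have a1 : (1 < a)%N.
  by case: a naJ {s t} => [|[|a]] //; rewrite ?exp0n ?exp1n // ltnS leqNgt n0.
rewrite -(ltn_exp2l _ _ a1); apply: leq_ltn_trans naJ.
rewrite [leqRHS](prod_primes_logn n0) /t.
have : {subset primes n <= primes n} by [].
elim: {1 3 4}(primes n) => [|p r IH] sub /=; first by rewrite big_nil.
have /IH {}IH : {subset r <= primes n}.
  by move=> q qr; apply: sub; rewrite inE qr orbT.
have : p \in primes n by apply: sub; rewrite mem_head.
rewrite big_cons mem_primes => /and3P[pp _ pn].
have pl : (p <= p ^ logn p n)%N.
  by rewrite -{1}(expn1 p) leq_pexp2l ?(prime_gt0 pp) // logn_gt0 mem_primes pp n0.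
case: ifP => ap /=; last first.
  by rewrite -[leqLHS]mul1n leq_mul // expn_gt0 prime_gt0.
by rewrite expnS leq_mul // (leq_trans (ltnW ap)).
Qed.

(** Double counting of the pairs (p, n) with p dividing n: [Psi (N %/ p) y] is the number of smooth
    multiples of p up to [N]. *)
Lemma sum_Psi_leq N a y J : (N < a ^ J.+1)%N ->
  (\sum_(a.+1 <= p < y.+1 | prime p) Psi (N %/ p) y <= J * Psi N y)%N.
Proof.
move=> NaJ.
have -> : (\sum_(a.+1 <= p < y.+1 | prime p) Psi (N %/ p) y =
  \sum_(a.+1 <= p < y.+1 | prime p)
     \sum_(1 <= n < N.+1 | smooth y n) (p %| n))%N.
  rewrite big_nat_cond [RHS]big_nat_cond; apply: eq_bigr => p.
  move=> /andP[/andP[_ py] pp]; rewrite -(Psi_multiples N pp py).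
  by rewrite big_mkcondr; apply: eq_bigr => n _; case: (_ %| _)%N.
rewrite exchange_big /Psi big_distrr /= big_nat_cond [leqRHS]big_nat_cond.
apply: leq_sum => n /andP[/andP[n0 nN] _]; rewrite muln1.
have nJ : (n < a ^ J.+1)%N by apply: leq_ltn_trans NaJ.
apply: leq_trans (count_large_primes_leq y.+1 n0 nJ).
by rewrite big_mkcondr; apply: leq_sum => p _; case: (_ %| _)%N.
Qed.

(** * From smooth numbers to perfect powers, and back *)

Lemma power_of_distinct_pow2 (R : realType) (x : R) (y k : nat) : 0 <= x ->
  (y * (2 ^ k).-1 < (Psi (Num.truncn x) y).-1)%N -> power_of_distinct x (2 ^ k).
Proof.
set N := Num.truncn x => x0.
have [->|N0] := posnP N; first by rewrite /Psi big_geq.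
rewrite PsiE //=; set ns := filter _ _ => sz.
set ps := [seq p <- iota 1 y | prime p].
have ns_gt1 n : n \in ns -> [/\ 2 <= n, n <= N & smooth y n]%N.
  rewrite mem_filter mem_iota => /and3P[sn n2 nN]; split=> //.
  by move: nN; rewrite -ltnS; case: (N) N0 => // M _; rewrite add2n.
have ns0 : all (leq 1) ns by apply/allP => n /ns_gt1[/ltnW].
(* The number of primes up to [y] is bounded crudely by [y]. *)
have szps : (size ps * (2 ^ k).-1 < size ns)%N.
  apply: leq_ltn_trans sz; rewrite leq_mul2r size_filter.
  by rewrite (leq_trans (count_size _ _)) ?size_iota // orbT.
have [t [t0 st divt]] := zero_sum_pow2 ns0 szps.
have tn n : n \in t -> [/\ 2 <= n, n <= N & smooth y n]%N.
  by move=> nt; apply: ns_gt1; apply: mem_subseq nt.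
set P := (\prod_(n <- t) n)%N in divt *.
have P2 : (2 <= P)%N.
  rewrite /P; case: (t) t0 tn => // a u _ tn; rewrite big_cons.
  have [a2 _ _] := tn a (mem_head _ _); rewrite (leq_trans a2) // leq_pmulr //.
  rewrite big_seq; apply: prodn_cond_gt0 => n nu.
  by have [/ltnW] := tn n (mem_behead (s := a :: u) nu).
have P0 : (0 < P)%N by apply: ltnW.
have w0 : (0 < 2 ^ k)%N by rewrite expn_gt0.
(* The root exists because [2 ^ k] divides every valuation of [P]; [P >= 2] will force [Y >= 2]. *)
pose Y := (\prod_(p <- primes P) p ^ (logn p P %/ 2 ^ k))%N.
have PY : P = (Y ^ (2 ^ k))%N.
  rewrite {1}(prod_primes_logn P0) /Y.
  rewrite (big_morph (expn^~ (2 ^ k)%N) (fun a b => expnMn a b _) (exp1n _)).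
  rewrite big_seq [RHS]big_seq; apply: eq_bigr => p.
  rewrite mem_primes -expnM => /and3P[pp _ pP]; rewrite divnK //; apply: divt.
  have [n nt pn] := prime_dvd_prod_seq pp pP.
  have [/ltnW n0 _ /(smoothP _ n0)/(_ p pp pn) py] := tn n nt.
  by rewrite mem_filter pp mem_iota prime_gt0 //= add1n ltnS.
exists t, Y; split=> //.
- apply: subseq_sorted st _; first exact: ltn_trans.
  by apply: sorted_filter; [exact: ltn_trans | exact: iota_ltn_sorted].
- move=> n nt; have [n2 nN _] := tn n nt; split; first exact: ltnW.
  by rewrite -truncn_ge_nat.
- rewrite leqNgt; apply/negP; rewrite ltnS => Y1.
  move: P2; rewrite PY ltnNge; apply/negP; rewrite negbK.
  by rewrite -{2}(exp1n (2 ^ k)) leq_exp2r.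
Qed.

Lemma power_of_distinct_leq_Psi (R : realType) (x : R) (v : nat) : 0 <= x ->
  (0 < v)%N -> power_of_distinct x v -> exists2 p, prime p &
  (v <= trunc_log 2 (Num.truncn x) * Psi (Num.truncn x %/ p) p)%N.
Proof.
set N := Num.truncn x => x0 v0 [s [y [s0 ss sx y2 sE]]].
have sN n : n \in s -> (1 <= n <= N)%N.
  by move=> /sx[-> nx]; rewrite truncn_ge_nat.
set p := max_pdiv y; have pp : prime p by rewrite max_pdiv_prime.
exists p => //; rewrite -(Psi_multiples _ pp (leqnn p)) big_distrr /=.
have us : uniq s by exact: sorted_uniq ltn_trans ltnn _ ss.
have sm n : n \in s -> smooth p n.
  move=> ns; have /andP[n0 _] := sN n ns.
  apply/(smoothP _ n0) => q pq qn; apply: max_pdiv_max.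
  rewrite mem_primes pq (ltnW y2) /=.
  have : (q %| y ^ v)%N by rewrite -sE (dvdn_trans qn) // (big_rem n) //= dvdn_mulr.
  by rewrite Euclid_dvdX // => /andP[].
have vlog : (v <= logn p (\prod_(n <- s) n))%N.
  rewrite sE lognX leq_pmulr // logn_gt0 mem_primes pp (ltnW y2).
  exact: max_pdiv_dvd.
apply: leq_trans vlog _.
have -> : (logn p (\prod_(n <- s) n) = \sum_(n <- s) logn p n)%N.
  elim: (s) sN => [|a t IH] tN; first by rewrite !big_nil logn1.
  have t1 n : n \in t -> (1 <= n <= N)%N by move=> nt; apply: tN; rewrite inE nt orbT.
  rewrite !big_cons lognM ?IH //; first by have /andP[] := tN a (mem_head _ _).
  by rewrite big_seq prodn_cond_gt0 // => n /t1 /andP[].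
(* Only multiples of [p] contribute, each with valuation at most [trunc_log 2 N]. *)
apply: (@leq_trans (\sum_(n <- s | p %| n) trunc_log 2 N)%N).
  rewrite [leqRHS]big_mkcond big_seq [leqRHS]big_seq; apply: leq_sum => n ns.
  have /andP[n0 nN] := sN n ns.
  case: ifP => pn; last by rewrite lognE pn !andbF.
  apply: trunc_log_max => //; apply: leq_trans nN.
  apply: leq_trans (dvdn_leq n0 (pfactor_dvdnn p n)).
  by case: (logn p n) => // i; rewrite leq_exp2r // prime_gt1.
rewrite -big_filter -[leqRHS]big_filter muln1 !big_const_seq !count_predT !iter_addn_0.
(* Here the factors must be distinct: the multiples of [p] in [s] form a subset of the smooth ones
   up to [N]. *)
rewrite leq_mul2l; apply/orP; right; apply: uniq_leq_size.
  exact: filter_uniq.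
move=> n; rewrite !mem_filter => /andP[-> ns]; rewrite sm //=.
by rewrite mem_index_iota ltnS sN.
Qed.

(** * Chebyshev and Mertens estimates *)

Lemma bin_leq_pow2 n k : ('C(n, k) <= 2 ^ n)%N.
Proof.
elim: n k => [|n IH] [|k]; rewrite ?bin0 ?bin0n ?expn_gt0 //.
by rewrite binS expnS mul2n -addnn leq_add.
Qed.

Lemma prime_dvd_fact p n : prime p -> (p %| n`!)%N -> (p <= n)%N.
Proof.
move=> pp; elim: n => [|n IH]; first by rewrite Euclid_dvd1.
by rewrite factS Euclid_dvdM // => /orP[/dvdn_leq->//|/IH/leqW].
Qed.

Lemma prod_primes_dvd (s : seq nat) b : uniq s ->
  (forall p, p \in s -> prime p /\ p %| b)%N -> (\prod_(p <- s) p %| b)%N.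
Proof.
elim: s => [|p s IH] /=; first by rewrite big_nil dvd1n.
move=> /andP[ps us] H; rewrite big_cons.
have [pp pb] := H p (mem_head _ _).
have Hs q : q \in s -> prime q /\ (q %| b)%N by move=> qs; apply: H; rewrite inE qs orbT.
rewrite Gauss_dvd ?pb ?IH // prime_coprime //; apply/negP.
move=> /(prime_dvd_prod_seq pp)[q qs]; have [pq _] := Hs q qs.
by rewrite dvdn_prime2 // => /eqP E; rewrite E qs in ps.
Qed.

(* The usual constant is 4; with 8 the bound ['C(n, k) <= 2 ^ n] is enough. *)
Lemma primorial_leq n : (\prod_(1 <= p < n.+1 | prime p) p <= 8 ^ n)%N.
Proof.
elim/ltn_ind: n => -[|[|[|n]]] IH.
- by rewrite big_geq.
- by rewrite unlock.
- by rewrite unlock.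
set m := (n.+3)./2; have [ev|od] := boolP (odd n.+3); last first.
  (* An even number above 2 is not prime, so the bound for [n.+2] is enough. *)
  rewrite big_mkcond big_nat_recr //= -big_mkcond ifF ?muln1.
    by rewrite (leq_trans (IH n.+2 _)) // leq_exp2l.
  apply/negP => pn; move: od; rewrite -dvdn2.
  by rewrite dvdn_prime2.
have nE : n.+3 = (m + m).+1 by rewrite addnn -[LHS](odd_double_half n.+3) ev.
have m0 : (0 < m)%N by [].
move: m nE m0 => m nE m0 {ev}.
rewrite nE (@big_cat_nat _ _ _ m.+2) //=; last by rewrite !ltnS leq_addr.
have H1 : (\prod_(1 <= p < m.+2 | prime p) p <= 8 ^ m.+1)%N.
  by apply: IH; rewrite nE ltnS -[leqLHS]addn1 leq_add2l.
(* These primes divide (2m+1)! but neither m! nor (m+1)!, hence they divide C(2m+1, m). *)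
have H2 : (\prod_(m.+2 <= p < (m + m).+2 | prime p) p <= 2 ^ (m + m).+1)%N.
  apply: leq_trans (bin_leq_pow2 _ m).
  apply: dvdn_leq; first by rewrite bin_gt0 leqW // leq_addr.
  rewrite -big_filter; apply: prod_primes_dvd.
    by rewrite filter_uniq ?iota_uniq.
  move=> p; rewrite mem_filter mem_index_iota => /and3P[pp mp pm]; split=> //.
  have : (p %| (m + m).+1`!)%N.
    by apply: dvdn_fact; rewrite prime_gt0.
  have mle : (m <= (m + m).+1)%N by rewrite leqW ?leq_addr.
  rewrite -(bin_fact mle) !Euclid_dvdM // => /or3P[//|H|H].
    by have := prime_dvd_fact pp H; rewrite leqNgt (ltn_trans _ mp).
  move: (prime_dvd_fact pp H).
  by rewrite -addSn addnK leqNgt mp.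
apply: leq_trans (leq_mul H1 H2) _.
rewrite -addSn [leqRHS]expnD leq_mul2l addSn; apply/orP; right.
rewrite -[8%N]/(2 ^ 3)%N -expnM leq_exp2l // !mulSn mul0n addn0 addnA -addn1.
by rewrite leq_add2l.
Qed.

Section Mertens.
Variable R : realType.
Implicit Types n p : nat.

Lemma ler_sum_nat_cond m n (P : pred nat) (F G : nat -> R) :
  (forall i, (m <= i < n)%N -> P i -> F i <= G i) ->
  \sum_(m <= i < n | P i) F i <= \sum_(m <= i < n | P i) G i.
Proof.
move=> FG; rewrite big_nat_cond [leRHS]big_nat_cond.
by apply: ler_sum => i /andP[mn Pi]; apply: FG.
Qed.

Lemma ln_nat_ge0 n : 0 <= ln (n%:R : R).
Proof. by case: n => [|n]; [rewrite ln0 | rewrite ln_ge0 // ler1n]. Qed.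

Lemma ln_natM m n : (0 < m)%N -> (0 < n)%N ->
  ln ((m * n)%:R : R) = ln m%:R + ln n%:R.
Proof. by move=> m0 n0; rewrite natrM lnM // posrE ltr0n. Qed.

Lemma ln2_le1 : ln (2 : R) <= 1.
Proof.
have := @le_ln1Dx R 1; rewrite -[1 + 1]/(2 : R); apply; lra.
Qed.

Lemma ln2_ge_half : 2^-1 <= ln (2 : R).
Proof.
have := @le_ln1Dx R (- 2^-1); rewrite (_ : 1 + - 2^-1 = 2^-1 :> R); last by lra.
by rewrite lnV ?posrE //; lra.
Qed.

Lemma ln8 : ln (8 : R) = 3 * ln 2.
Proof.
rewrite -[8%:R]/((2 ^ 3)%N%:R) natrX lnXn ?ltr0n // mulr_natl //.
Qed.

Lemma theta_leq n :
  \sum_(1 <= p < n.+1 | prime p) ln (p%:R : R) <= n%:R * ln 8.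
Proof.
have -> : \sum_(1 <= p < n.+1 | prime p) ln (p%:R : R) =
    ln (\prod_(1 <= p < n.+1 | prime p) p)%N%:R.
  elim: n => [|n IH]; first by rewrite !big_geq // ln1.
  rewrite big_mkcond big_nat_recr // -big_mkcond IH.
  rewrite [in RHS]big_mkcond big_nat_recr //= -big_mkcond.
  case: ifP => _; last by rewrite muln1 addr0.
  by rewrite ln_natM // prodn_cond_gt0 // => p /prime_gt0.
rewrite mulr_natl -lnXn // -natrX ler_ln ?posrE ?ltr0n ?expn_gt0 //.
  by rewrite ler_nat primorial_leq.
by rewrite prodn_cond_gt0 // => p /prime_gt0.
Qed.

Lemma ln_logn n N : (0 < n)%N -> (n <= N)%N ->
  ln (n%:R : R) = \sum_(1 <= p < N.+1 | prime p) (logn p n)%:R * ln p%:R.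
Proof.
move=> n0 nN; rewrite -{1}(partnT n0) (widen_partn _ nN).
have -> : (\prod_(0 <= p < N.+1 | p \in predT) p ^ logn p n =
           \prod_(1 <= p < N.+1 | prime p) p ^ logn p n)%N.
  rewrite big_ltn //= mul1n [RHS]big_mkcond; apply: eq_bigr => p _.
  by case: ifP => // pp; rewrite lognE pp.
elim: (N) => [|M IH]; first by rewrite !big_geq // ln1.
rewrite big_mkcond big_nat_recr //= -big_mkcond.
rewrite [in RHS]big_mkcond big_nat_recr //= -big_mkcond -IH.
case: ifP => _; last by rewrite muln1 addr0.
rewrite ln_natM ?expn_gt0 //; last by rewrite prodn_cond_gt0 // => p /prime_gt0 p0; rewrite expn_gt0 p0.
by rewrite natrX lnXn ?ltr0n // mulr_natl.
Qed.

Lemma ln_fact_logn N :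
  ln (N`!%:R : R) = \sum_(1 <= p < N.+1 | prime p) (logn p N`!)%:R * ln p%:R.
Proof.
suff H n : (n <= N)%N ->
  ln (n`!%:R : R) = \sum_(1 <= p < N.+1 | prime p) (logn p n`!)%:R * ln p%:R.
  exact: H.
elim: n => [|n IH] nN.
  by rewrite ln1 big1 // => p _; rewrite logn1 mul0r.
rewrite factS ln_natM ?fact_gt0 // IH 1?ltnW // (ln_logn _ nN) //.
rewrite -big_split /=; apply: eq_bigr => p _.
by rewrite lognM ?fact_gt0 // natrD mulrDl.
Qed.

(** Weak Stirling bound; the induction step is n ln(1 + 1/n) <= 1. *)
Lemma ln_fact_ge n : n%:R * ln n%:R - n%:R <= ln (n`!%:R : R).
Proof.
elim: n => [|n IH]; first by rewrite mul0r subr0 ln1.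
rewrite factS ln_natM ?fact_gt0 //.
have [->|n0] := posnP n; first by rewrite mul1r ln1; lra.
have n0R : 0 < n%:R :> R by rewrite ltr0n.
have H : n%:R * (ln n.+1%:R - ln n%:R) <= 1 :> R.
  rewrite -ln_div ?posrE ?ltr0n //.
  rewrite (_ : n.+1%:R / n%:R = 1 + n%:R^-1 :> R); last first.
    by rewrite -natr1 mulrDl mul1r divff // gt_eqF.
  rewrite mulrC -ler_pdivlMr // div1r le_ln1Dx //.
  by rewrite (lt_trans (ltrN10 _)) ?invr_gt0.
rewrite -natr1 in H *; nra.
Qed.

Lemma ln_fact_le n : ln (n`!%:R : R) <= n%:R * ln n%:R.
Proof.
elim: n => [|n IH]; first by rewrite mul0r ln1.
rewrite factS ln_natM ?fact_gt0 //.
have [->|n0] := posnP n; first by rewrite mul1r ln1; lra.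
have H : ln n%:R <= ln n.+1%:R :> R by rewrite ler_ln ?posrE ?ltr0n // ler_nat.
have n0R : 0 < n%:R :> R by rewrite ltr0n.
rewrite -{2}natr1; nra.
Qed.

Lemma logn_fact_mul_leq p n : prime p -> (logn p n`! * p.-1 <= n)%N.
Proof.
move=> pp; have p0 := prime_gt0 pp; rewrite logn_fact //.
(* Keeping the last quotient on the left makes the geometric sum of Legendre's formula telescope. *)
suff H m : ((\sum_(1 <= k < m.+1) n %/ p ^ k) * p.-1 + n %/ p ^ m <= n)%N.
  exact: leq_trans (leq_addr _ _) (H n).
elim: m => [|m IH]; first by rewrite big_geq // mul0n expn0 divn1.
apply: leq_trans IH; rewrite big_nat_recr //= mulnDl -addnA leq_add2l.
rewrite -{2}[(n %/ _)%N]muln1 -mulnDr addn1 prednK //.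
by rewrite expnSr divnMA leq_divM.
Qed.

(** Legendre gives v_p(n!) <= n / (p - 1); insert this in ln n! = sum of v_p(n!) ln p and compare
    with Stirling. *)
Lemma sum_ln_pred_ge n : (0 < n)%N ->
  ln n%:R - 1 <= \sum_(1 <= p < n.+1 | prime p) ln p%:R / (p.-1)%:R :> R.
Proof.
move=> n0; have n0R : 0 < n%:R :> R by rewrite ltr0n.
rewrite -(ler_pM2l n0R) mulrBr mulr1.
apply: (le_trans (ln_fact_ge n)); rewrite ln_fact_logn mulr_sumr.
apply: ler_sum => p pp.
have p1 : 0 < (p.-1)%:R :> R by rewrite ltr0n -ltnS prednK ?prime_gt1 ?prime_gt0.
rewrite mulrCA mulrC ler_wpM2l ?ln_nat_ge0 // ler_pdivlMr //.
by rewrite -natrM ler_nat logn_fact_mul_leq.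
Qed.

(** Conversely v_p(n!) >= n/p - 1, and the total loss is the Chebyshev sum, at most n ln 8. *)
Lemma sum_ln_div_le n : (0 < n)%N ->
  \sum_(1 <= p < n.+1 | prime p) ln p%:R / p%:R <= ln n%:R + ln 8 :> R.
Proof.
move=> n0; have n0R : 0 < n%:R :> R by rewrite ltr0n.
rewrite -(ler_pM2l n0R) mulrDr -lerBlDr.
apply: le_trans (ln_fact_le n).
apply: le_trans (_ : _ - \sum_(1 <= p < n.+1 | prime p) ln p%:R <= _).
  by rewrite lerB // theta_leq.
rewrite ln_fact_logn mulr_sumr -sumrB; apply: ler_sum_nat_cond => p pn pp.
have p0 := prime_gt0 pp; have p0R : 0 < p%:R :> R by rewrite ltr0n.
have nq : n%:R <= ((n %/ p).+1 * p)%:R :> R by rewrite ler_nat ltnW // ltn_ceil.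
have ql : (n %/ p <= logn p n`!)%N.
  rewrite logn_fact // big_nat_recl; last by case/andP: pn => p1 pn; apply: n0.
  by rewrite expn1 leq_addr.
rewrite (_ : _ - _ = (n%:R / p%:R - 1) * ln p%:R); last first.
  by rewrite mulrBl mul1r mulrA mulrAC.
rewrite ler_wpM2r ?ln_nat_ge0 // lerBlDr ler_pdivrMr // natr1.
by rewrite (le_trans nq) // -natrM ler_nat leq_mul2r ltnS ql orbT.
Qed.

(* (ln n + 2) / n decreases by at least ln n / (n (n - 1)) from n - 1 to n. *)
Lemma sum_ln_sq_le n : (0 < n)%N ->
  \sum_(2 <= k < n.+1) ln k%:R / (k%:R * (k.-1)%:R) <= 2 - (ln n%:R + 2) / n%:R :> R.
Proof.
case: n => // n _; elim: n => [|n IH]; first by rewrite big_geq // ln1; lra.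
rewrite big_nat_recr //=.
have a0 : 0 < n.+1%:R :> R by rewrite ltr0n.
have a1 : 1 <= n.+1%:R :> R by rewrite ler1n.
have E : n.+2%:R = n.+1%:R + 1 :> R by rewrite natr1.
move: (n.+1%:R) IH a0 a1 E => a IH a0 a1 E.
rewrite E; have H : (a + 1) * (ln (a + 1) - ln a) <= 1 + a^-1.
  rewrite -ln_div ?posrE ?addr_gt0 //.
  rewrite (_ : (a + 1) / a = 1 + a^-1); last by rewrite mulrDl divff ?mul1r // gt_eqF.
  have : ln (1 + a^-1) <= a^-1.
    by rewrite le_ln1Dx // (lt_trans (ltrN10 _)) ?invr_gt0.
  move/(ler_wpM2l (ltW (addr_gt0 a0 ltr01)))/le_trans; apply.
  by rewrite mulrDl divff ?mul1r // gt_eqF.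
have ia : a^-1 <= 1 by rewrite invf_le1.
apply: le_trans (lerD IH (lexx _)) _.
rewrite -addrA lerD2l -subr_ge0.
rewrite (_ : _ - _ = (2 - (a+1) * (ln (a + 1) - ln a)) / (a * (a + 1))); last first.
  by field; rewrite !gt_eqF ?addr_gt0.
apply: divr_ge0; last by rewrite mulr_ge0 ?addr_ge0 ?ltW.
lra.
Qed.

(** Uses 1/(p-1) = 1/p + 1/(p(p-1)); the constant comes from ln 8 + 2 <= 5. *)
Lemma sum_ln_pred_le n : (0 < n)%N ->
  \sum_(1 <= p < n.+1 | prime p) ln p%:R / (p.-1)%:R <= ln n%:R + 5 :> R.
Proof.
move=> n0.
have H : \sum_(1 <= p < n.+1 | prime p) ln p%:R / (p.-1)%:R <=
  \sum_(1 <= p < n.+1 | prime p) ln p%:R / p%:R +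
  \sum_(2 <= k < n.+1) ln k%:R / (k%:R * (k.-1)%:R) :> R.
  have -> : \sum_(2 <= k < n.+1) ln k%:R / (k%:R * (k.-1)%:R) =
     \sum_(1 <= k < n.+1) ln k%:R / (k%:R * (k.-1)%:R) :> R.
    by rewrite [RHS]big_ltn // ln1 mul0r add0r.
  rewrite big_mkcond [X in _ <= X + _]big_mkcond -big_split /=.
  apply: ler_sum => p _; case: ifP => pp; last first.
    by rewrite add0r divr_ge0 ?ln_nat_ge0 ?mulr_ge0.
  have p1 := prime_gt1 pp.
  have E : p%:R = (p.-1)%:R + 1 :> R by rewrite natr1 prednK // ltnW.
  have p0 : 0 < (p.-1)%:R :> R by rewrite ltr0n -ltnS prednK // ltnW.
  rewrite E le_eqVlt; apply/orP; left; apply/eqP; field.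
  by rewrite !gt_eqF ?addr_gt0.
have := sum_ln_div_le n0; have := sum_ln_sq_le n0.
have : 0 <= (ln n%:R + 2) / n%:R :> R by rewrite divr_ge0 // addr_ge0 ?ln_nat_ge0.
have := ln2_le1; rewrite ln8; move: H; lra.
Qed.

(** Subtracts the two Mertens bounds, with 6 = 1 + 5. The factor 2 covers p/(p-1) <= 2, and ln p <=
    ln y. *)
Lemma sum_inv_primes_window a y : (0 < a)%N -> (a <= y)%N -> (1 < y)%N ->
  ln y%:R - ln a%:R - 6 <=
  2 * ln y%:R * \sum_(a.+1 <= p < y.+1 | prime p) p%:R^-1 :> R.
Proof.
move=> a0 ay y1; have y0 : (0 < y)%N by apply: ltnW.
have H1 := sum_ln_pred_ge y0; have H2 := sum_ln_pred_le a0.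
move: H1; rewrite (@big_cat_nat _ _ _ a.+1) //= => H1.
suff : \sum_(a.+1 <= p < y.+1 | prime p) ln p%:R / (p.-1)%:R <=
  2 * ln y%:R * \sum_(a.+1 <= p < y.+1 | prime p) p%:R^-1 :> R by move: H1 H2; lra.
rewrite mulr_sumr; apply: ler_sum_nat_cond => p /andP[ap py] pp.
have p1 := prime_gt1 pp.
have E : p%:R = (p.-1)%:R + 1 :> R by rewrite natr1 prednK // ltnW.
have q1 : 1 <= (p.-1)%:R :> R by rewrite ler1n -ltnS prednK // ltnW.
rewrite [leLHS]mulrC mulrAC ler_pM ?ln_nat_ge0 ?invr_ge0 //.
- by rewrite ler_pdivlMr ?ltr0n ?prime_gt0 // mulrC ler_pdivrMr; lra.
- by rewrite ler_ln ?posrE ?ltr0n ?(prime_gt0 pp) ?ler_nat.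
Qed.

(** Each block from N = 2^(2^k) to N^2 contributes at most 5: there ln p >= ln N, while the sum of
    ln p / p is at most 2 ln N + ln 8 <= 5 ln N. *)
Lemma sum_inv_primes_le k n : (n <= 2 ^ 2 ^ k)%N ->
  \sum_(1 <= p < n.+1 | prime p) p%:R^-1 <= 5 * k%:R + 1 :> R.
Proof.
have mono n' N : (n' <= N)%N -> \sum_(1 <= p < n'.+1 | prime p) p%:R^-1 <=
    \sum_(1 <= p < N.+1 | prime p) p%:R^-1 :> R.
  move=> nN; rewrite [leRHS](@big_cat_nat _ _ _ n'.+1) //= lerDl sumr_ge0 // => p _.
  by rewrite invr_ge0.
move/mono/le_trans; apply; elim: k => [|k IH].
  rewrite big_mkcond /= unlock /=; lra.
set N := (2 ^ 2 ^ k)%N in IH *; set N' := (2 ^ 2 ^ k.+1)%N.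
have NN' : (N <= N')%N by rewrite leq_exp2l // leq_exp2l.
have N0 : (0 < N)%N by rewrite expn_gt0.
have N'0 : (0 < N')%N by rewrite expn_gt0.
rewrite (@big_cat_nat _ _ _ N.+1) //=.
have l2 := ln2_ge_half.
have lnN : ln N%:R = 2 ^+ k * ln 2 :> R by rewrite natrX lnXn // -[LHS]mulr_natl natrX.
have lnN' : ln N'%:R = 2 * (2 ^+ k * ln 2) :> R.
  by rewrite natrX lnXn // -[LHS]mulr_natl natrX exprS mulrA.
have k1 : 1 <= 2 ^+ k :> R by rewrite exprn_ege1 // ler1n.
have lnN0 : 0 < ln N%:R :> R by rewrite lnN mulr_gt0 //; lra.
suff H : ln N%:R * \sum_(N.+1 <= p < N'.+1 | prime p) p%:R^-1 <= ln N%:R * 5 :> R.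
  by rewrite ler_pM2l // in H; rewrite -natr1; move: IH H; lra.
apply: (@le_trans _ _ (ln N'%:R + ln 8)); last first.
  rewrite ln8 lnN lnN'; nra.
apply: le_trans (sum_ln_div_le N'0).
rewrite [leRHS](@big_cat_nat _ _ _ N.+1) //= -[leLHS]add0r lerD //.
  by apply: sumr_ge0 => p _; rewrite divr_ge0 ?ln_nat_ge0.
rewrite mulr_sumr; apply: ler_sum_nat_cond => p /andP[Np pN'] pp.
rewrite ler_wpM2r ?invr_ge0 // ler_ln ?posrE ?ltr0n ?(prime_gt0 pp) //.
by rewrite ler_nat ltnW.
Qed.

End Mertens.

(** * Bounds for smooth numbers *)

Lemma Psi0n y : Psi 0 y = 0%N.
Proof. by rewrite /Psi big_geq. Qed.

Lemma Psin0_leq1 N : (Psi N 0 <= 1)%N.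
Proof.
case: N => [|N]; first by rewrite Psi0n.
rewrite /Psi big_mkcond big_ltn //= big_nat_cond big1 // => n /andP[/andP[n1 _] _].
by case: ifP => // /(smoothP _ (ltnW n1))/(_ _ (pdiv_prime n1) (pdiv_dvd n)); rewrite leqNgt pdiv_gt0.
Qed.

(** This is 1/(1 - t) <= exp(4t), a bound for one Euler factor, in the form that fits [Psi_primeS].
    It rests on (1 - t)(1 + 2t)^2 = 1 + t(3 - 4t^2). *)
Lemma le_expR_euler_factor (R : realType) (t : R) : 0 <= t -> t ^+ 2 <= 2^-1 ->
  1 + t * expR (4 * t) <= expR (4 * t).
Proof.
move=> t0 t2.
have E : expR (4 * t) = expR (2 * t) ^+ 2.
  by rewrite expr2 -expRD; congr expR; ring.
have H : 1 + 2 * t <= expR (2 * t) := expR_ge1Dx _.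
have H2 : (1 + 2 * t) ^+ 2 <= expR (4 * t).
  by rewrite E lerXn2r // nnegrE ?expR_ge0 //; lra.
have t1 : t <= 1 by nra.
have : (1 - t) * (1 + 2 * t) ^+ 2 <= (1 - t) * expR (4 * t).
  by rewrite ler_wpM2l //; lra.
nra.
Qed.

(* Rankin's upper bound, with the Euler product bounded by an exponential. *)
Lemma Psi_le_rankin (R : realType) (s : R) N y : 2^-1 <= s ->
  (Psi N y)%:R <= expR (s * ln N%:R + 4 * \sum_(1 <= q < y.+1 | prime q) expR (- s * ln q%:R)).
Proof.
move=> s2.
have [->|N0] := posnP N; first by rewrite Psi0n expR_ge0.
elim: y N N0 => [|y IH] N N0.
  rewrite big_geq // mulr0 addr0 (@le_trans _ _ 1) //.
    by rewrite lern1 Psin0_leq1.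
  by rewrite -[leLHS]expR0 ler_expR mulr_ge0 ?ln_nat_ge0 //; lra.
rewrite big_mkcond big_nat_recr //= -big_mkcond.
have [py|py] := boolP (prime y.+1); last by rewrite addr0 Psi_nprimeS // IH.
set T := \sum_(_ <= _ < _ | _) _ in IH *; set q := y.+1 in py *.
set t := expR (- s * ln q%:R).
have q0 := prime_gt0 py; have q0R : 0 < q%:R :> R by rewrite ltr0n.
have t0 : 0 <= t by apply: expR_ge0.
have t2 : t ^+ 2 <= 2^-1.
  rewrite expr2 -expRD; apply: (@le_trans _ _ (expR (- ln q%:R))).
    have : 0 <= ln q%:R * (2 * s - 1) by rewrite mulr_ge0 ?ln_nat_ge0 //; lra.
    rewrite ler_expR; lra.
  by rewrite expRN lnK ?posrE // lef_pV2 ?posrE // ler_nat prime_gt1.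
have key := le_expR_euler_factor t0 t2.
(* The second term of Buchstab's identity keeps the same prime [q], so an inner induction on [N] is
   required. *)
elim/ltn_ind: N N0 => N IHN N0.
rewrite Psi_primeS // natrD -/q mulrDr addrA [leRHS]expRD.
set E := expR (s * ln N%:R + 4 * T).
have H1 : (Psi N y)%:R <= E by apply: IH.
suff H2 : (Psi (N %/ q) q)%:R <= E * (t * expR (4 * t)).
  apply: le_trans (lerD H1 H2) _.
  by rewrite -[X in X + _]mulr1 -mulrDr ler_wpM2l // expR_ge0.
have [->|Nq0] := posnP (N %/ q).
  by rewrite Psi0n !mulr_ge0 ?expR_ge0.
have qN : (N %/ q < N)%N by rewrite ltn_Pdiv // prime_gt1.
apply: le_trans (IHN _ qN Nq0) _.
rewrite /E /t mulrA -!expRD ler_expR.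
have : ln (N %/ q)%:R <= ln N%:R - ln q%:R :> R.
  rewrite -ln_div ?posrE ?ltr0n // ler_ln ?posrE ?divr_gt0 ?ltr0n //.
  by rewrite ler_pdivlMr // -natrM ler_nat leq_divM.
rewrite -/t; nra.
Qed.

(* Each [n < a ^ J.+1] has at most [J] prime factors above [a], so
   [J * Psi N y] dominates the sum of [Psi (N %/ p) y] over [a < p <= y]; the
   factor 2 absorbs the rounding in [N %/ p]. *)
Lemma Psi_ge_iter (R : realType) (t : R) N a y J j :
  0 <= t -> t <= 1 -> (0 < y)%N -> (0 < J)%N ->
  2 * J%:R * t <= \sum_(a.+1 <= p < y.+1 | prime p) p%:R^-1 ->
  (N < a ^ J.+1)%N -> (N <= a ^ j)%N -> N%:R * t ^+ j <= (Psi N y)%:R.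
Proof.
move=> t0 t1 y0 J0 Ht; have J0R : 0 < J%:R :> R by rewrite ltr0n.
elim: j N => [|j IH] N NJ Nj.
  by rewrite mulr1 Psi_small // (leq_trans Nj).
have [Ny|yN] := leqP N y.
  by rewrite Psi_small // ler_piMr // exprn_ile1.
have a0 : (0 < a)%N by case: a {Ht NJ IH} Nj => //; rewrite exp0n // leqNgt (leq_trans _ yN).
rewrite -(ler_pM2l J0R).
apply: (@le_trans _ _ (\sum_(a.+1 <= p < y.+1 | prime p) (Psi (N %/ p) y)%:R)); last first.
  by rewrite -natr_sum -natrM ler_nat sum_Psi_leq.
apply: (@le_trans _ _ (\sum_(a.+1 <= p < y.+1 | prime p) N%:R / 2 * t ^+ j * p%:R^-1)).
  rewrite -mulr_sumr.
  have -> : J%:R * (N%:R * t ^+ j.+1) = N%:R / 2 * t ^+ j * (2 * J%:R * t).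
    by rewrite exprS; field.
  by rewrite ler_wpM2l // !mulr_ge0 ?invr_ge0 ?exprn_ge0.
apply: ler_sum_nat_cond => p /andP[ap py] pp; have p0 := prime_gt0 pp.
have p0R : 0 < p%:R :> R by rewrite ltr0n.
apply: le_trans (IH (N %/ p)%N _ _).
- rewrite mulrAC ler_wpM2r ?exprn_ge0 // ler_pdivrMr // ler_pdivrMr //.
  rewrite -!natrM ler_nat mulnAC.
  have Np : (0 < N %/ p)%N by rewrite divn_gt0 // (leq_trans _ (ltnW yN)).
  rewrite (leq_trans (ltnW (ltn_ceil N p0))) // leq_mul2r -addn1 muln2 -addnn leq_add2l Np orbT //.
- exact: leq_ltn_trans (leq_div _ _) NJ.
(* Dividing by a prime above [a] lowers the exponent [j] by one. *)
- rewrite -(@leq_pmul2r p) // (leq_trans (leq_divM _ _)) // (leq_trans Nj) //.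
  by rewrite expnSr leq_mul2l ltnW ?orbT.
Qed.

(** * Upper bound *)

Section Asymptotics.
Variable R : realType.
Implicit Types (x d e m : R).

Lemma expR_ge_sqr (u : R) : 0 <= u -> u ^+ 2 / 4 <= expR u.
Proof.
move=> u0; have H : 1 + u / 2 <= expR (u / 2) := expR_ge1Dx _.
have -> : expR u = expR (u / 2) ^+ 2 by rewrite expr2 -expRD; congr expR; field.
nra.
Qed.

(** Rounding down costs at most 1 in the logarithm, since w - 1 >= w/2 >= w/e for w >= 2. *)
Lemma ln_truncn_expR (z : R) : 1 <= z ->
  z - 1 <= ln (Num.truncn (expR z))%:R <= z /\ (0 < Num.truncn (expR z))%N.
Proof.
move=> z1; set w := expR z.
have w2 : 2 <= w by have := expR_ge1Dx z; rewrite -/w; lra.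
have w0 : 0 <= w by lra.
have /andP[tw wt] := truncn_itv w0.
have t0 : (0 < Num.truncn w)%N by rewrite truncn_gt0; lra.
have t0R : 0 < (Num.truncn w)%:R :> R by rewrite ltr0n.
split=> //; apply/andP; split; last first.
  by rewrite -[leRHS]expRK ler_ln ?posrE // (lt_le_trans t0R).
rewrite -[leLHS]expRK ler_ln ?posrE ?expR_gt0 //.
have e2 : 2 <= expR (1 : R) by have := expR_ge1Dx (1 : R); lra.
have : expR (z - 1) * expR 1 = w by rewrite -expRD subrK.
have := expR_gt0 (z - 1); rewrite -natr1 in wt; nra.
Qed.

Lemma Lfun_facts x : 3 <= x -> 64 <= ln (ln x) ->
  [/\ ln x = expR (ln (ln x)), Lfun x ^+ 2 = ln x * ln (ln x),
      expR (ln (ln x) / 2) <= Lfun x, (ln (ln x)) ^+ 2 / 16 <= Lfun x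
    & Lfun x <= ln x].
Proof.
move=> x3; set m := ln (ln x) => m64.
have l0 : 0 < ln x by rewrite ln_gt0 //; lra.
have m0 : 0 < m by lra.
have lE : ln x = expR m by rewrite /m lnK.
have LE : Lfun x ^+ 2 = ln x * m by rewrite /Lfun sqr_sqrtr // mulr_ge0 // ltW.
have L0 : 0 <= Lfun x by apply: sqrtr_ge0.
have qE : expR (m / 2) ^+ 2 = ln x.
  by rewrite lE expr2 -expRD; congr expR; field.
have qL : expR (m / 2) <= Lfun x.
  rewrite -(@ler_pXn2r _ 2%N) ?nnegrE ?expR_ge0 // qE LE; nra.
split=> //.
- have m20 : 0 <= m / 2 by lra.
  apply: le_trans qL; apply: le_trans (expR_ge_sqr m20).
  by rewrite expr_div_n; lra.
- rewrite -(@ler_pXn2r _ 2%N) ?nnegrE ?(ltW l0) // LE expr2 ler_pM2l // lE.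
  by have := expR_ge1Dx m; lra.
Qed.

Lemma sum_inv_primes_le_lnln x (y : nat) : 1 <= ln x -> 0 <= ln (ln x) ->
  ln y%:R <= ln x -> (0 < y)%N ->
  \sum_(1 <= p < y.+1 | prime p) p%:R^-1 <= 10 * ln (ln x) + 11.
Proof.
move=> lx1; set m := ln (ln x) => m0 yx y0.
(* As ln 2 >= 1/2, this choice gives 2^k >= 2 ln x, hence 2^k ln 2 >= ln x; and 5k + 1 <= 10m +
   11. *)
set k := (Num.truncn (2 * m)).+2.
have m20 : 0 <= 2 * m by lra.
have /andP[k1 k2] := truncn_itv m20.
have kR : k%:R = (Num.truncn (2 * m))%:R + 2 :> R by rewrite /k -!natr1; ring.
have lE : ln x = expR m by rewrite /m lnK // posrE; lra.
have l2 := ln2_ge_half R.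
have yk : (y <= 2 ^ 2 ^ k)%N.
  rewrite -(ler_nat R) -ler_ln ?posrE ?ltr0n ?expn_gt0 // natrX lnXn ?ltr0n //.
  apply: le_trans yx _; rewrite lE -[leRHS]mulr_natl natrX.
  have -> : 2 ^+ k = expR (k%:R * ln 2) :> R by rewrite expRM_natl lnK ?posrE ?ltr0n.
  have H1 : m + ln 2 <= k%:R * ln 2 by rewrite -natr1 in k2; nra.
  have H2 : expR (m + ln 2) = expR m * 2 by rewrite expRD lnK // posrE ltr0n.
  rewrite -ler_expR H2 in H1; have := expR_gt0 m; nra.
apply: le_trans (sum_inv_primes_le R yk) _; rewrite kR; lra.
Qed.

(* Rankin's bound with exponent [1 - (1 - e) * ln (ln x) / (2 * ell)]. *)
Lemma power_of_distinct_le_expR x e ell (p y v : nat) :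
  3 <= x -> 64 <= ln (ln x) -> 0 < e -> e <= 4^-1 ->
  prime p -> (p <= y)%N -> ln y%:R <= ell -> ln y%:R <= ln x ->
  Lfun x / 4 <= ell ->
  (v <= trunc_log 2 (Num.truncn x) * Psi (Num.truncn x %/ p) p)%N ->
  v%:R <= x * expR (- ln p%:R - (1 - e) * Lfun x ^+ 2 / (2 * ell) +
    (3 / 2 * ln (ln x) + 1 + 4 * expR ((1 - e) * ln (ln x) / 2) * (10 * ln (ln x) + 11))).
Proof.
move=> x3 m64 e0 e1 pp py yell yx Lell.
have [lE LE qL mL Ll] := Lfun_facts x3 m64.
set N := Num.truncn x; set M := (N %/ p)%N.
set m := ln (ln x) in m64 lE LE qL mL *; set L := Lfun x in LE qL mL Ll Lell *.
have x0 : 0 < x by lra.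
have p0 := prime_gt0 pp; have p0R : 0 < p%:R :> R by rewrite ltr0n.
have y0 : (0 < y)%N by apply: leq_trans py.
have [->|M0] := posnP M.
  by rewrite Psi0n muln0 leqn0 => /eqP ->; rewrite mulr_ge0 ?expR_ge0 // ltW.
have L0 : 0 < L by apply: lt_le_trans qL; apply: expR_gt0.
have ell0 : 0 < ell by lra.
have mell : m <= ell by nra.
have N0 : (0 < N)%N by rewrite truncn_gt0; lra.
have NX : N%:R <= x by rewrite truncn_le ltW.
have lnpy : ln p%:R <= ln y%:R :> R by rewrite ler_ln ?posrE ?ltr0n // ler_nat.
(* The factor x^(-eta) is the saving. For primes q <= y, q^eta stays below (ln x)^((1-e)/2), which
   keeps the prime sum of order o(L). *)
pose eta := (1 - e) * m / (2 * ell).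
have etaE : eta * ell = (1 - e) * m / 2 by rewrite /eta; field; rewrite gt_eqF.
have eta0 : 0 <= eta by rewrite divr_ge0 ?mulr_ge0 //; lra.
have eta2 : eta <= 2^-1 by rewrite /eta ler_pdivrMr; nra.
have etal : eta * ln x = (1 - e) * L ^+ 2 / (2 * ell).
  by rewrite LE /eta; field; rewrite gt_eqF.
clearbody eta.
have lnM : ln M%:R <= ln x - ln p%:R.
  rewrite -ln_div ?posrE // ler_ln ?posrE ?divr_gt0 ?ltr0n //.
  by rewrite ler_pdivlMr // (le_trans _ NX) // -natrM ler_nat leq_divM.
have lnM0 := ln_nat_ge0 R M.
have lnp0 := ln_nat_ge0 R p.
have sum_le : \sum_(1 <= q < y.+1 | prime q) expR (- (1 - eta) * ln q%:R) <=
    expR ((1 - e) * m / 2) * (10 * m + 11).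
  apply: (@le_trans _ _ (expR ((1 - e) * m / 2) * \sum_(1 <= q < y.+1 | prime q) q%:R^-1)).
    rewrite mulr_sumr; apply: ler_sum_nat_cond => q /andP[q1 qy] pq.
    have q0 : 0 < q%:R :> R by rewrite ltr0n.
    have lq : ln q%:R <= ln y%:R :> R by rewrite ler_ln ?posrE ?ltr0n // ler_nat.
    rewrite (_ : - (1 - eta) * ln q%:R = eta * ln q%:R - ln q%:R); last by ring.
    rewrite expRD expRN lnK ?posrE // ler_wpM2r ?invr_ge0 ?(ltW q0) // ler_expR -etaE.
    by rewrite ler_wpM2l // (le_trans lq).
  rewrite ler_wpM2l ?expR_ge0 //; apply: sum_inv_primes_le_lnln => //; last by rewrite -/m; lra.
  by rewrite lE; have := expR_ge1Dx m; lra.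
have Psi_le : (Psi M p)%:R <= expR (ln x - ln p%:R - (1 - e) * L ^+ 2 / (2 * ell)
    + m / 2 + 4 * expR ((1 - e) * m / 2) * (10 * m + 11)).
  apply: (@le_trans _ _ (Psi M y)%:R); first by rewrite ler_nat leq_Psi.
  apply: le_trans (@Psi_le_rankin R (1 - eta) M y _) _; first by lra.
  rewrite ler_expR -etal -!mulrA; apply: lerD; last by rewrite ler_pM2l // mulrA.
  have : (1 - eta) * ln M%:R <= (1 - eta) * (ln x - ln p%:R) by rewrite ler_wpM2l //; lra.
  have : eta * ln p%:R <= eta * ell by rewrite ler_wpM2l // (le_trans lnpy).
  have : 0 <= e * m by rewrite mulr_ge0 //; lra.
  rewrite etaE. lra.
have log_le : (trunc_log 2 N)%:R <= expR (m + 1).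
  have : (2 ^ trunc_log 2 N)%:R <= x by rewrite (le_trans _ NX) // ler_nat trunc_logP.
  rewrite -ler_ln ?posrE ?ltr0n ?expn_gt0 // natrX lnXn ?ltr0n // -[leLHS]mulr_natl.
  move=> H; have l2 := ln2_ge_half R.
  have e2 : 2 <= expR (1 : R) by have := expR_ge1Dx (1 : R); lra.
  have T0 : 0 <= (trunc_log 2 N)%:R :> R by [].
  rewrite expRD -lE; nra.
rewrite -(ler_nat R) natrM => /le_trans; apply.
apply: le_trans (ler_pM _ _ log_le Psi_le) _ => //.
have xE u : x * expR u = expR (ln x + u) by rewrite expRD lnK.
by rewrite xE -expRD ler_expR; lra.
Qed.

(** The error has order (ln x)^((1-e)/2) ln ln x, and exp(e m / 2) with m = ln ln x outgrows m. *)
Lemma error_le x e : 3 <= x -> 0 < e -> e <= 1 -> 2688 / e ^+ 3 <= ln (ln x) ->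
  3 / 2 * ln (ln x) + 1 + 4 * expR ((1 - e) * ln (ln x) / 2) * (10 * ln (ln x) + 11)
    <= e * Lfun x.
Proof.
move=> x3 e0 e1 me.
have e3 : 0 < e ^+ 3 by rewrite exprn_gt0.
have e31 : e ^+ 3 <= 1 by rewrite exprn_ile1 // ltW.
have m2688 : 2688 <= ln (ln x).
  by apply: le_trans me; rewrite ler_pdivlMr //; lra.
have m64 : 64 <= ln (ln x) by lra.
have [lE LE qL mL _] := Lfun_facts x3 m64.
set m := ln (ln x) in me m2688 m64 lE LE qL mL *.
rewrite ler_pdivrMr // in me.
have emE : expR ((1 - e) * m / 2) * expR (e * m / 2) = expR (m / 2).
  by rewrite -expRD; congr expR; field.
have em : (e * m / 2) ^+ 2 / 4 <= expR (e * m / 2).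
  by apply: expR_ge_sqr; rewrite divr_ge0 ?mulr_ge0 //; lra.
have mq : (m / 2) ^+ 2 / 4 <= expR (m / 2).
  by apply: expR_ge_sqr; lra.
(* Here 84m bounds 4(10m + 11), and 2688 = 32 * 84. *)
have H1 : 84 * m <= e / 2 * expR (e * m / 2).
  apply: (@le_trans _ _ (e / 2 * ((e * m / 2) ^+ 2 / 4))); last first.
    by rewrite ler_wpM2l // divr_ge0 // ltW.
  rewrite (_ : e / 2 * ((e * m / 2) ^+ 2 / 4) = (m * e ^+ 3) * m / 32); last by field.
  nra.
have H2 : 4 * expR ((1 - e) * m / 2) * (10 * m + 11) <= e / 2 * expR (m / 2).
  rewrite -emE; have := expR_gt0 ((1 - e) * m / 2).
  move: (expR ((1 - e) * m / 2)) (expR (e * m / 2)) H1 => A B H1 A0.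
  have : A * (84 * m) <= A * (e / 2 * B) by rewrite ler_wpM2l // ltW.
  nra.
have em96 : 96 <= e * m.
  have : e ^+ 3 <= e.
    by rewrite exprS ler_piMr ?(ltW e0) // exprn_ile1 ?(ltW e0).
  nra.
have H3 : 3 / 2 * m + 1 <= e / 2 * expR (m / 2).
  have : e / 2 * ((m / 2) ^+ 2 / 4) <= e / 2 * expR (m / 2) by rewrite ler_wpM2l //; lra.
  nra.
have : e * expR (m / 2) <= e * Lfun x by rewrite ler_wpM2l // ltW.
lra.
Qed.

Lemma sqrt2_sqr : Num.sqrt 2 ^+ 2 = 2 :> R.
Proof. by rewrite sqr_sqrtr. Qed.

Lemma sqrt2_bounds : 4 / 3 <= Num.sqrt (2 : R) <= 3 / 2.
Proof.
have := sqrt2_sqr; have := sqrtr_ge0 (2 : R).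
move: (Num.sqrt _) => r r0 r2; apply/andP; split; nra.
Qed.

Lemma power_of_distinct_upper x e v : 3 <= x -> 0 < e -> e <= 4^-1 ->
  2688 / e ^+ 3 <= ln (ln x) -> (0 < v)%N -> power_of_distinct x v ->
  v%:R <= x * expR (- (Num.sqrt 2 - 3 * e) * Lfun x).
Proof.
move=> x3 e0 e1 me v0 Pv.
have x0 : 0 < x by lra.
have e11 : e <= 1 by lra.
have m64 : 64 <= ln (ln x).
  have e3 : 0 < e ^+ 3 by rewrite exprn_gt0.
  have e31 : e ^+ 3 <= 1 by rewrite exprn_ile1 // ltW.
  by apply: le_trans me; rewrite ler_pdivlMr //; nra.
have err := error_le x3 e0 e11 me.
have [lE LE qL mL Ll] := Lfun_facts x3 m64.
have L0 : 0 < Lfun x by apply: lt_le_trans qL; apply: expR_gt0.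
have /andP[r1 r2] := sqrt2_bounds; have r3 := sqrt2_sqr.
have [p pp vp] := power_of_distinct_leq_Psi (ltW x0) v0 Pv.
have p0R : 0 < p%:R :> R by rewrite ltr0n prime_gt0.
have lnp0 : 0 < ln p%:R :> R by rewrite ln_gt0 // ltr1n prime_gt1.
(* For small [p], enlarging the smoothness bound to exp(L/4) already saves 2(1 - e)L, more than
   enough because 2 > sqrt 2. For larger [p], take [ell = ln p]. *)
have [pL|pL] := leP (ln (p%:R : R)) (Lfun x / 4).
  have L4 : 1 <= Lfun x / 4 by nra.
  have [/andP[_ yL] y0] := ln_truncn_expR L4.
  set y := Num.truncn _ in yL y0.
  have py : (p <= y)%N.
    by rewrite truncn_ge_nat ?expR_ge0 // -ler_ln ?posrE ?expR_gt0 // expRK.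
  have yx : ln y%:R <= ln x by apply: le_trans yL _; lra.
  apply: le_trans (power_of_distinct_le_expR x3 m64 e0 e1 pp py yL yx (lexx _) vp) _.
  rewrite ler_pM2l // ler_expR.
  have -> : (1 - e) * Lfun x ^+ 2 / (2 * (Lfun x / 4)) = 2 * (1 - e) * Lfun x.
    by field; rewrite gt_eqF.
  move: err; nra.
have [px|px] := leqP p (Num.truncn x); last first.
  by move: vp; rewrite divn_small // Psi0n muln0 leqNgt v0.
have pxR : p%:R <= x by rewrite -truncn_ge_nat // ltW.
have lpx : ln p%:R <= ln x by rewrite ler_ln ?posrE.
apply: le_trans (power_of_distinct_le_expR x3 m64 e0 e1 pp (leqnn p) (lexx _) lpx (ltW pL) vp) _.
rewrite ler_pM2l // ler_expR.
set u := ln (p%:R : R) in lnp0 *.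
suff : Num.sqrt 2 * (1 - e) * Lfun x <= u + (1 - e) * Lfun x ^+ 2 / (2 * u).
  have : 0 <= e * Lfun x * (2 - Num.sqrt 2) by rewrite !mulr_ge0 ?(ltW e0) ?(ltW L0) //; lra.
  by move: err; lra.
set r := Num.sqrt 2 in r1 r2 r3 *; set L := Lfun x in L0 *.
rewrite -subr_ge0.
(* AM-GM by completing the square; since r^2 = 2, the remainder has the sign of e(1 - e). *)
have -> : u + (1 - e) * L ^+ 2 / (2 * u) - r * (1 - e) * L =
  ((u - r * (1 - e) * L / 2) ^+ 2 + (2 - r ^+ 2 * (1 - e)) * (1 - e) * L ^+ 2 / 4) / u.
  by field; rewrite gt_eqF.
apply: divr_ge0; last exact: ltW.
rewrite r3; have := sqr_ge0 (u - r * (1 - e) * L / 2).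
have : 0 <= e * (1 - e) * L ^+ 2 by rewrite !mulr_ge0 ?sqr_ge0 //; lra.
lra.
Qed.

End Asymptotics.

(** * Lower bound *)

Section LowerBound.
Variable R : realType.
Implicit Types (x d : R).

(** Take for 2^k the largest power of two up to (Psi - 1)/y; this rounding loses at most a factor
    2. *)
Lemma Psi_le_largest_exponent x (y : nat) : 3 <= x -> (0 < y)%N ->
  (Psi (Num.truncn x) y <= 4 * y * largest_exponent x)%N.
Proof.
move=> x3 y0; have [w1 _ wmax] := largest_exponentP x3.
set w := largest_exponent x in w1 wmax *; set P := Psi _ _.
have x0 : 0 <= x by lra.
have yw : (y <= y * w)%N by rewrite leq_pmulr.
have [T0|T0] := posnP (P.-1 %/ y).
  have := ltn_ceil P.-1 y0; rewrite T0 mul1n => /(leq_trans (leqSpred P))/leq_trans.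
  by apply; rewrite -mulnA (leq_trans yw) // leq_pmull.
set k := trunc_log 2 (P.-1 %/ y).
have kle : (2 ^ k <= P.-1 %/ y)%N by rewrite trunc_logP.
have ykP : (y * 2 ^ k <= P.-1)%N by rewrite mulnC -leq_divRL.
have kw : (2 ^ k <= w)%N.
  apply: wmax; first by rewrite expn_gt0.
  apply: (power_of_distinct_pow2 (y := y)) => //; apply: leq_trans ykP.
  by rewrite ltn_pmul2l // prednK // expn_gt0.
have : (P.-1 < 2 ^ k.+1 * y)%N by rewrite -ltn_divLR // trunc_log_ltn.
move/(leq_trans (leqSpred P))/leq_trans; apply.
rewrite expnS -mulnA (mulnC (2 ^ k)%N) mulnA.
by apply: leq_mul => //; rewrite leq_mul2r orbT.
Qed.

(** With a and y near exp((1-d) lam) and exp(lam), the window has logarithmic length at least d lam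
    - 1. After the loss of 6, at least d lam / 2 is left, to be divided by 2 lam. *)
Lemma sum_inv_primes_window_ge (lam d : R) : 0 < d -> d <= 8^-1 -> 14 <= d * lam ->
  exists a y : nat, [/\ (1 < a)%N, (0 < y)%N, y%:R <= expR lam,
    (1 - 2 * d) * lam <= ln a%:R
    & d / 4 <= \sum_(a.+1 <= p < y.+1 | prime p) p%:R^-1].
Proof.
move=> d0 d1 dlam.
have lam1 : 112 <= lam by nra.
have dlam1 : 98 <= (1 - d) * lam by nra.
have [/andP[y1 y2] y0] := @ln_truncn_expR R lam ltac:(lra).
have [/andP[a1 a2] a0] := @ln_truncn_expR R ((1 - d) * lam) ltac:(lra).
have ay : (Num.truncn (expR ((1 - d) * lam)) <= Num.truncn (expR lam))%N.
  by apply: le_truncn; rewrite ler_expR; lra.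
exists (Num.truncn (expR ((1 - d) * lam))), (Num.truncn (expR lam)).
move: (Num.truncn (expR lam)) (truncn_le (expR lam)) y1 y2 y0 ay => y.
rewrite expR_ge0 => yle y1 y2 y0.
move: (Num.truncn _) a1 a2 a0 => a a1 a2 a0 ay.
have gt1 n : 0 < ln (n%:R : R) -> (1 < n)%N.
  by case: n => [|[|n]] //; [rewrite ln0 // | rewrite ln1]; rewrite ltxx.
have yy : (1 < y)%N by apply: gt1; lra.
split=> //; [by apply: gt1; lra | lra |].
have := sum_inv_primes_window R a0 ay yy.
have : 0 <= \sum_(a.+1 <= p < y.+1 | prime p) p%:R^-1 :> R.
  by apply: sumr_ge0 => p _; rewrite invr_ge0.
move: (\sum_(_ <= _ < _ | _) _) (ln _) (ln _) y1 y2 a1 a2 => S u v y1 y2 a1 a2 S0 H.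
nra.
Qed.

Lemma Psi_ge_expR x (lam d : R) : 3 <= x -> 0 < d -> d <= 8^-1 -> 14 <= d * lam ->
  exists y J : nat, [/\ (0 < y)%N, y%:R <= expR lam, (0 < J)%N,
    J%:R <= ln x / ((1 - 2 * d) * lam) + 1
    & (Num.truncn x)%:R * expR (- (J%:R * (ln J%:R + ln (8 / d)))) <=
      (Psi (Num.truncn x) y)%:R].
Proof.
move=> x3 d0 d1 dlam.
have [a [y [a1 y0 yle lna Sd]]] := sum_inv_primes_window_ge d0 d1 dlam.
have x0 : 0 < x by lra.
have l0 : 0 < ln x by rewrite ln_gt0 //; lra.
have lna' : 0 < (1 - 2 * d) * lam by nra.
have lna0 : 0 < ln (a%:R : R) := lt_le_trans lna' lna.
(* Least convenient [J] with [x <= a ^ J]; it serves both as number of iterations and as bound on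
   the prime factors above [a]. *)
pose J := (Num.truncn (ln x / ln a%:R)).+1.
have Jl : ln x <= J%:R * ln a%:R.
  by rewrite -ler_pdivrMr // ltW // truncnS_gt.
have JA : J%:R <= ln x / ((1 - 2 * d) * lam) + 1.
  rewrite /J -natr1 lerD2r (@le_trans _ _ (ln x / ln a%:R)) //.
    by rewrite truncn_le divr_ge0 // ltW.
  by rewrite ler_wpM2l ?(ltW l0) // lef_pV2.
have J0 : (0 < J)%N by [].
move: J J0 Jl JA => J J0 Jl JA; exists y, J; split=> //.
have a0 : (0 < a)%N := ltnW a1.
have NaJ : (Num.truncn x <= a ^ J)%N.
  rewrite -(ler_nat R); apply: le_trans (_ : _ <= x) _; first by rewrite truncn_le ltW.
  rewrite -ler_ln ?posrE ?ltr0n ?expn_gt0 ?a0 // natrX lnXn ?ltr0n //.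
  by rewrite -[leRHS]mulr_natl.
have NaJ1 : (Num.truncn x < a ^ J.+1)%N.
  by apply: leq_ltn_trans NaJ _; rewrite ltn_exp2l.
have J0R : 0 < J%:R :> R by rewrite ltr0n.
have J1 : 1 <= J%:R :> R by rewrite ler1n.
(* Chosen so that 2Jt = d/4, the lower bound for the window. *)
pose t := d / (8 * J%:R).
have t0 : 0 < t by rewrite divr_gt0 // mulr_gt0.
have tJ : t * J%:R = d / 8 by rewrite /t; field; rewrite gt_eqF.
have tE : t ^+ J = expR (- (J%:R * (ln J%:R + ln (8 / d)))).
  have -> : t = expR (- (ln J%:R + ln (8 / d))).
    rewrite expRN expRD !lnK ?posrE ?divr_gt0 // /t.
    by field; rewrite !gt_eqF.
  by rewrite -expRM_natl mulrN.
rewrite -tE; apply: (Psi_ge_iter (ltW t0) _ y0 J0 _ NaJ1 NaJ).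
  by move: t t0 tJ {tE} => t t0 tJ; nra.
by apply: le_trans Sd; rewrite -mulrA (mulrC _ t) tJ; lra.
Qed.

(** Up to the error terms, J is l/lam and ln J is at most m/2, so J ln J is about l m / (2 lam) =
    L^2 / (2 lam) = lam. *)
Lemma lower_exponent_le (l m L lam d K J : R) :
  0 < d -> d <= 8^-1 -> 64 <= m -> 0 <= K -> 4 * K <= d * m ->
  l = expR m -> 0 < L -> L ^+ 2 = l * m -> lam * (2 * lam) = L ^+ 2 ->
  2 / 3 * L <= lam -> lam <= L -> 1 <= J -> J <= l / ((1 - 2 * d) * lam) + 1 ->
  J * (ln J + K) <= lam + 5 * d * L + m / 2 + K.
Proof.
move=> d0 d1 m64 K0 Kdm lE L0 LE lam2 lamL lamL' J1 JA.
have lam0 : 0 < lam by lra.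
have c0 : 3 / 4 <= 1 - 2 * d by lra.
have c0' : 1 - 2 * d != 0 by rewrite gt_eqF //; lra.
set A := l / _ in JA.
have AE : A * ((1 - 2 * d) * lam) = l.
  by rewrite /A divfK // mulf_neq0 // gt_eqF.
have A0 : 0 <= A.
  by rewrite divr_ge0 ?lE ?expR_ge0 // mulr_ge0 // ?(ltW lam0) //; lra.
move: A A0 AE JA => A A0 AE JA.
have Am : A * m * (1 - 2 * d) = 2 * lam.
  apply: (mulIf (lt0r_neq0 lam0)).
  transitivity (A * ((1 - 2 * d) * lam) * m); first by ring.
  by rewrite AE -LE -lam2; ring.
have Jq : J <= expR (m / 2).
  have q2 : 2 <= expR (m / 2) by have := expR_ge1Dx (m / 2); lra.
  have qE : l = expR (m / 2) * expR (m / 2).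
    by rewrite lE -expRD; congr expR; field.
  move: (expR (m / 2)) q2 qE => q q2 qE.
  have L4q : 4 * q <= L.
    by rewrite -(@ler_pXn2r _ 2%N) ?nnegrE ?(ltW L0) ?mulr_ge0 // ?LE ?qE; clear -m64 q2; nra.
  suff : A <= q / 2 by lra.
  have lamq : 8 / 3 * q <= lam by lra.
  have H1 : 2 * q <= (1 - 2 * d) * lam by clear -lamq c0 q2; nra.
  have : A * (2 * q) <= q * q by rewrite -qE -AE ler_wpM2l.
  by clear -q2; nra.
have lnJ : ln J <= m / 2.
  by rewrite -[leRHS]expRK ler_ln ?posrE ?expR_gt0 //; lra.
apply: (@le_trans _ _ ((A + 1) * (m / 2 + K))).
  by apply: ler_pM => //; rewrite ?lerD2r ?addr_ge0 ?ln_ge0 //; lra.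
have Am0 : 0 <= A * m by rewrite mulr_ge0 //; lra.
(* From 1/(1 - 2d) <= 1 + 4d. *)
have Am2 : A * m <= (1 + 4 * d) * (2 * lam).
  have : 0 <= (A * m) * (d * (1 - 4 * d)) by rewrite !mulr_ge0 ?(ltW d0) //; lra.
  by rewrite -Am; clear; lra.
have dl : d * lam <= d * L by rewrite ler_wpM2l // ltW.
have H1 : A * (4 * K) <= A * (d * m) by rewrite ler_wpM2l.
have H2 : d * (A * m) <= d * (4 * lam).
  rewrite ler_wpM2l ?(ltW d0) //; clear -Am2 d1 lam0; nra.
clear -Am2 dl H1 H2 Am0; lra.
Qed.

Lemma largest_exponent_lower x d : 3 <= x -> 0 < d -> d <= 8^-1 ->
  64 + 100 / d + 4 * ln (8 / d) / d <= ln (ln x) ->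
  x * expR (- (Num.sqrt 2 + 6 * d) * Lfun x) <= (largest_exponent x)%:R.
Proof.
move=> x3 d0 d1 md.
have x0 : 0 < x by lra.
have K0 : 0 <= ln (8 / d) by rewrite ln_ge0 // ler_pdivlMr //; lra.
have dmK : 64 * d + 100 + 4 * ln (8 / d) <= d * ln (ln x).
  apply: (@le_trans _ _ (d * (64 + 100 / d + 4 * ln (8 / d) / d))); last by rewrite ler_pM2l.
  by rewrite le_eqVlt; apply/orP; left; apply/eqP; field; rewrite gt_eqF.
have m800 : 800 <= ln (ln x) by clear -dmK K0 d0 d1; nra.
have m64 : 64 <= ln (ln x) by lra.
have [lE LE _ mL _] := Lfun_facts x3 m64.
have mL2 : 50 * ln (ln x) <= Lfun x by clear -mL m800; nra.
have L0 : 0 < Lfun x by lra.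
have /andP[r1 r2] := sqrt2_bounds R; have r3 := sqrt2_sqr R.
(* L / sqrt 2 minimises lam + L^2 / (2 lam): the first term is the cost of dividing by y, the second
   that of the iteration. *)
pose lam := Num.sqrt 2 * Lfun x / 2.
have lamL : 2 / 3 * Lfun x <= lam by rewrite /lam; clear -r1 L0; nra.
have lamL' : lam <= Lfun x by rewrite /lam; clear -r2 L0; nra.
have lam2 : lam * (2 * lam) = Lfun x ^+ 2.
  have -> : lam * (2 * lam) = Num.sqrt 2 ^+ 2 * Lfun x ^+ 2 / 2 by rewrite /lam; field.
  by rewrite r3; field.
have rL : Num.sqrt 2 * Lfun x = 2 * lam by rewrite /lam; field.
clearbody lam; clear r1 r2 r3.
have dlam : 14 <= d * lam.
  have : d * ln (ln x) <= d * lam by rewrite ler_wpM2l ?(ltW d0) //; lra.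
  by clear -dmK K0 d0; lra.
have [y [J [y0 yle J0 JA PsiN]]] := Psi_ge_expR x3 d0 d1 dlam.
have J1 : 1 <= J%:R :> R by rewrite ler1n.
have Kdm : 4 * ln (8 / d) <= d * ln (ln x) by clear -dmK d0; lra.
have Ele := lower_exponent_le d0 d1 m64 K0 Kdm lE L0 LE lam2 lamL lamL' J1 JA.
set E := J%:R * _ in Ele PsiN.
have := Psi_le_largest_exponent x3 y0; rewrite -(ler_nat R) !natrM.
set w := (largest_exponent x)%:R => Pw.
have w0 : 0 <= w by [].
have Nx : x / 2 <= (Num.truncn x)%:R.
  by have /andP[_] := truncn_itv (ltW x0); rewrite -natr1; clear -x3; lra.
have final : x / 2 * expR (- E) <= 4 * expR lam * w.
  apply: (@le_trans _ _ ((Num.truncn x)%:R * expR (- E))).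
    by rewrite ler_wpM2r ?expR_ge0.
  apply: le_trans PsiN _; apply: le_trans Pw _.
  by rewrite ler_wpM2r // ler_wpM2l.
(* exp 3 absorbs the 4 of [Psi_le_largest_exponent] and the 2 lost in rounding [x]. *)
have e3 : 8 <= expR (3 : R).
  have e2 : 2 <= expR (1 : R) by have := expR_ge1Dx (1 : R); clear; lra.
  have -> : expR (3 : R) = expR 1 ^+ 3 by rewrite -expRM_natl mulr1.
  have : 2 ^+ 3 <= expR (1 : R) ^+ 3 by rewrite lerXn2r // nnegrE ?expR_ge0.
  by clear; lra.
apply: (@le_trans _ _ (x * expR (- E - lam - 3))); last first.
  rewrite -(@ler_pM2r _ (expR (lam + 3))) ?expR_gt0 // -mulrA -expRD.
  rewrite (_ : - E - lam - 3 + (lam + 3) = - E); last by ring.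
  rewrite expRD; have : expR lam * w * 8 <= expR lam * w * expR 3.
    by apply: ler_wpM2l e3; apply: mulr_ge0 w0; apply: expR_ge0.
  by move: final; clear; lra.
rewrite ler_pM2l // ler_expR mulNr mulrDl rL.
(* One more d L pays for m/2 + K + 3, which raises 5d to 6d. *)
have : d * (ln (ln x) ^+ 2 / 16) <= d * Lfun x by rewrite ler_wpM2l // ltW.
have : 100 * ln (ln x) <= d * ln (ln x) * ln (ln x).
  by rewrite ler_wpM2r; clear -dmK K0 d0 m800; lra.
have : d * ln (ln x) <= ln (ln x) by rewrite ler_piMl; clear -d1 m800; lra.
by move: Ele Kdm m800; clear; lra.
Qed.

End LowerBound.

Theorem mainTheorem1 (R : realType) :
  forall eps : R, 0 < eps ->
  exists x0 : R, forall x : R, 3 <= x -> x0 <= x ->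
    x * expR (- (Num.sqrt 2 + eps) * Lfun x) <= (largest_exponent x)%:R
    /\ (largest_exponent x)%:R <= x * expR (- (Num.sqrt 2 - eps) * Lfun x).
Proof.
move=> eps eps0.
have [d [d0 d1 deps]] : exists d : R, [/\ 0 < d, d <= 8^-1 & 6 * d <= eps].
  have [H|H] := leP eps 8^-1; [exists (eps / 6) | exists (48^-1)]; split; lra.
pose m0 := Num.max (64 + 100 / d + 4 * ln (8 / d) / d) (2688 / d ^+ 3).
(* Beyond this point ln ln x >= m0, the threshold of both bounds. *)
exists (expR (expR m0)) => x x3 xx0.
have x0 : 0 < x by lra.
have lx : expR m0 <= ln x by rewrite -ler_expR lnK.
have : m0 <= ln (ln x) by rewrite -ler_expR lnK // posrE (lt_le_trans _ lx) ?expR_gt0.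
rewrite ge_max => /andP[m1 m2].
have L0 : 0 <= Lfun x by apply: sqrtr_ge0.
have [w1 Pw _] := largest_exponentP x3; split.
  apply: le_trans (largest_exponent_lower x3 d0 d1 m1).
  by rewrite ler_pM2l // ler_expR ler_wpM2r //; lra.
apply: le_trans (power_of_distinct_upper x3 d0 _ m2 w1 Pw) _; first by lra.
by rewrite ler_pM2l // ler_expR ler_wpM2r //; lra.
Qed.
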